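(* Assume that (i) all non-slack nodes are injection nodes; (ii) gas flows only in the positive direction through each edge according to its orientation in the network graph, i.e. $\varphi_k(t)>0$ for every $k\in\mathcal E$; (iii) pressure is positive at each node; and (iv) the density-ratio condition stated in the context is satisfied. Suppose that the nodal concentration vector $\eta^{(2)}$ (hence $\eta^{(1)}=1-\eta^{(2)}$) is constant and that there exist two state solutions $p_1,p_2$ on $[0,T]$ of the isolated total pressure system (defined in the context), with respective initial conditions $\pi_1,\pi_2$, slack node pressures $(p_s)_1,(p_s)_2$, and non-slack injection flows $q_1,q_2$, for a given fixed set of control inputs $\{\underline\mu,\overline\mu\}$. (Here the subscripts $1,2$ label the two solutions, not the nodes.) Suppose that $\pi_1\le\pi_2$, $(p_s)_1(t)\le(p_s)_2(t)$, and $q_1(t)\ge q_2(t)$ componentwise for all $t\in[0,T]$. Then, for $m=1$ and $m=2$, $\rho_1^{(m)}(t)\le\rho_2^{(m)}(t)$ componentwise for all $t\in[0,T]$, where $\rho_1^{(m)}$ and $\rho_2^{(m)}$ are the vectors of nodal partial densities of gas $m$ of the two solutions.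
   Context: Network. A connected directed graph has a finite edge set $\mathcal E$ and a finite node set $\mathcal V=\mathcal V_s\sqcup\mathcal V_d$ (slack and non-slack nodes). $k:i\mapsto j$ means edge $k$ is directed from node $i$ to node $j$. Every edge ends at a non-slack node, and every non-slack node has at least one incoming edge. Each edge $k$ has constants $\ell_k,D_k,\lambda_k>0$ (length, diameter, friction factor), and $\chi_k=\pi D_k^2/4$, $\Lambda_k=\sqrt{2D_k/(\lambda_k\ell_k)}$. The control inputs are piecewise-continuous functions $\underline\mu_k(t)\ge1$ (compression at the edge inlet) and $\overline\mu_k(t)\ge1$ (regulation at the edge outlet), $k\in\mathcal E$. Gas mixture. There are two gases $m=1,2$ with wave speeds $\sigma_1,\sigma_2>0$. Concentrations (mass fractions) of the two gases lie in $[0,1]$ and sum to $1$: $\alpha_i^{(m)}$ is prescribed at slack nodes $i\in\mathcal V_s$, $\beta_j^{(m)}$ is the prescribed concentration of the gas injected at node $j$, and $\eta_j^{(m)}$ is the concentration at the non-slack node $j\in\mathcal V_d$, assumed constant. Put $a_i^2=\sigma_1^2\alpha_i^{(1)}+\sigma_2^2\alpha_i^{(2)}$, $b_j^2=\sigma_1^2\beta_j^{(1)}+\sigma_2^2\beta_j^{(2)}$, $c_j^2=\sigma_1^2\eta_j^{(1)}+\sigma_2^2\eta_j^{(2)}$, with $a_i,b_j,c_j>0$. The network, the edge parameters, the control inputs and the concentrations $\alpha,\beta,\eta$ are the same for both solutions. Isolated total pressure system (all non-slack nodes being injection nodes). The state is the vector of pressures $p_j(t)$, $j\in\mathcal V_d$;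 the input parameters are the slack pressures $(p_s)_i(t)$, $i\in\mathcal V_s$, and the flow vector $d(t)=-q(t)$, where $q_j(t)\ge0$, $j\in\mathcal V_d$, is the mass inflow at node $j$ (piecewise continuous in $t$). Write $p_i=(p_s)_i$ and $\theta_i^2=a_i^2$ for $i\in\mathcal V_s$, and $\theta_i^2=c_i^2$ for $i\in\mathcal V_d$. For an edge $k:i\mapsto j$ define the mass flux $$\varphi_k=\operatorname{sign}(\underline\mu_kp_i-\overline\mu_kp_j)\,\Lambda_k\left|\frac{\overline\mu_kp_j}{c_j^2}\,(\underline\mu_kp_i-\overline\mu_kp_j)\right|^{1/2}.$$ The system is, for each $j\in\mathcal V_d$, $$r_j\dot p_j=\sum_{k:i\mapsto j}\theta_i^2\chi_k\varphi_k-\sum_{k:j\mapsto i}c_j^2\chi_k\varphi_k+b_j^2q_j,\qquad r_j=\sum_{k:i\mapsto j}\chi_k\ell_k\overline\mu_k>0 .$$ Densities. The total density at $j\in\mathcal V_d$ is $\rho_j=p_j/c_j^2$ and the nodal partial density of gas $m$ is $\rho_j^{(m)}=\eta_j^{(m)}\rho_j$. At slack nodes $i\in\mathcal V_s$ the partial densities are $s_i^{(m)}=\alpha_i^{(m)}(p_s)_i/a_i^2$. Density-ratio condition. For an edge $k:i\mapsto j$, the inlet and outlet partial densities are $\underline\rho_k^{(m)}=\underline\mu_ks_i^{(m)}$ if $i\in\mathcal V_s$, $\underline\rho_k^{(m)}=\underline\mu_k\rho_i^{(m)}$ if $i\in\mathcal V_d$, and $\overline\rho_k^{(m)}=\overline\mu_k\rho_j^{(m)}$.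 The condition is that, for some $\epsilon\le1$, for all $k\in\mathcal E$ and $m=1,2$, $$\frac{|\overline\rho_k^{(m)}-\underline\rho_k^{(m)}|}{\underline\rho_k^{(m)}}<\epsilon,\qquad \frac{|\overline\rho_k^{(m)}-\underline\rho_k^{(m)}|}{\overline\rho_k^{(m)}}<\epsilon .$$
   Formalization: The inequality between the injection flows is reversed: the theorem assumes q_1(t) ≤ q_2(t) (that is, d_1 ≥ d_2 for d = −q) instead of q_1(t) ≥ q_2(t), since injecting more gas raises the pressure and the claim fails with the printed sign. *)

(* Defs.v *)
From mathcomp Require Import all_boot all_order all_algebra.
From mathcomp Require Import all_classical all_reals all_analysis.
Import Order.TTheory GRing.Theory Num.Theory.
Import numFieldNormedType.Exports.

Set Implicit Arguments.
Unset Strict Implicit.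
Unset Printing Implicit Defensive.

Local Open Scope classical_set_scope.
Local Open Scope ring_scope.

(* The node set is the disjoint union [slack + nonslack].  Since [head] takes
   values in [nonslack], every edge ends at a non-slack node.  No slack node has
   an incoming edge, so connectedness is that of the underlying undirected
   graph. *)
Record network (R : realType) := Network {
  slack : finType;
  nonslack : finType;
  edge : finType;
  tail : edge -> slack + nonslack;
  head : edge -> nonslack;
  len : edge -> R;
  diam : edge -> R;
  fric : edge -> R;
  network_connected : forall u v : slack + nonslack,
    connect (fun x y => [exists k, ((tail k == x) && (inr (head k) == y)) ||
                                   ((tail k == y) && (inr (head k) == x))]) u v;
  network_incoming : forall j : nonslack, exists k, head k = j;
  len_gt0 : forall k, 0 < len k;
  diam_gt0 : forall k, 0 < diam k;
  fric_gt0 : forall k, 0 < fric k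
}.

Record controls (R : realType) (N : network R) := Controls {
  mu_in : R -> edge N -> R;
  mu_out : R -> edge N -> R
}.

(* The two gases are indexed by ['I_2].  The nodal concentrations [eta] do not
   depend on time; the prescribed concentrations [alpha] and [beta] may. *)
Record mixture (R : realType) (N : network R) := Mixture {
  sigma : 'I_2 -> R;
  alpha : R -> slack N -> 'I_2 -> R;
  beta : R -> nonslack N -> 'I_2 -> R;
  eta : nonslack N -> 'I_2 -> R
}.

Definition concentration (R : realType) (x : 'I_2 -> R) : Prop :=
  (forall m, 0 <= x m <= 1) /\ \sum_m x m = 1.

Definition piecewise_continuous (R : realType) (T : R) (f : R -> R) : Prop :=
  [/\ exists s : seq R, forall t, 0 < t < T -> t \notin s -> {for t, continuous f},
      forall t, 0 <= t < T -> cvg (f x @[x --> t^'+])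
    & forall t, 0 < t <= T -> cvg (f x @[x --> t^'-])].

Section System.
Variables (R : realType) (N : network R) (C : controls N) (M : mixture N).

Definition admissible_controls (T : R) : Prop :=
  forall k,
    [/\ forall t, 0 <= t <= T -> 1 <= mu_in C t k,
        forall t, 0 <= t <= T -> 1 <= mu_out C t k,
        piecewise_continuous T (fun t => mu_in C t k)
      & piecewise_continuous T (fun t => mu_out C t k)].

Definition admissible_mixture (T : R) : Prop :=
  [/\ forall m, 0 < sigma M m,
      forall t i, 0 <= t <= T -> concentration (alpha M t i),
      forall t j, 0 <= t <= T -> concentration (beta M t j)
    & forall j, concentration (eta M j)].

(* Only the squares of the local wave speeds enter the equations. *)
Definition mix_speed2 (x : 'I_2 -> R) : R := \sum_m sigma M m ^+ 2 * x m.

Definition a2 (t : R) (i : slack N) : R := mix_speed2 (alpha M t i).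
Definition b2 (t : R) (j : nonslack N) : R := mix_speed2 (beta M t j).
Definition c2 (j : nonslack N) : R := mix_speed2 (eta M j).

Definition theta2 (t : R) (v : slack N + nonslack N) : R :=
  match v with inl i => a2 t i | inr j => c2 j end.

Definition chi (k : edge N) : R := pi * diam k ^+ 2 / 4.
Definition Lam (k : edge N) : R := Num.sqrt (2 * diam k / (fric k * len k)).

Definition node_pressure (ps : slack N -> R) (p : nonslack N -> R)
    (v : slack N + nonslack N) : R :=
  match v with inl i => ps i | inr j => p j end.

Definition flux (t : R) (ps : slack N -> R) (p : nonslack N -> R)
    (k : edge N) : R :=
  let y := mu_in C t k * node_pressure ps p (tail k) in
  let x := mu_out C t k * p (head k) in
  Num.sg (y - x) * Lam k * Num.sqrt `|x / c2 (head k) * (y - x)|.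

Definition capacity (t : R) (j : nonslack N) : R :=
  \sum_(k | head k == j) chi k * len k * mu_out C t k.

Definition net_inflow (t : R) (ps : slack N -> R) (p q : nonslack N -> R)
    (j : nonslack N) : R :=
  \sum_(k | head k == j) theta2 t (tail k) * chi k * flux t ps p k
  - \sum_(k | tail k == inr j) c2 j * chi k * flux t ps p k
  + b2 t j * q j.

(* For piecewise continuous inputs a solution is a continuous function that
   satisfies the differential equation except at finitely many times. *)
Definition solution (T : R) (pi0 : nonslack N -> R) (ps : R -> slack N -> R)
    (q : R -> nonslack N -> R) (p : R -> nonslack N -> R) : Prop :=
  [/\ forall j, p 0 j = pi0 j,
      forall j, {within `[0, T], continuous (fun t => p t j)}
    & exists s : seq R, forall t j, 0 < t < T -> t \notin s ->
        derivable (fun u => p u j) t 1 /\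
        capacity t j * derive1 (fun u => p u j) t
          = net_inflow t (ps t) (p t) (q t) j].

Definition injection_flow (T : R) (q : R -> nonslack N -> R) : Prop :=
  forall j, (forall t, 0 <= t <= T -> 0 <= q t j) /\
            piecewise_continuous T (fun t => q t j).

(* The flow input of the system is [d = - q].  Injected mass raises pressure, so
   the state is monotone decreasing in [d], hence increasing in [q]; inputs must
   be compared through [d]. *)
Definition flow_input (q : R -> nonslack N -> R) : R -> nonslack N -> R :=
  fun t j => - q t j.

Definition positive_flow (T : R) (ps : R -> slack N -> R)
    (p : R -> nonslack N -> R) : Prop :=
  forall t k, 0 <= t <= T -> 0 < flux t (ps t) (p t) k.

Definition positive_pressure (T : R) (ps : R -> slack N -> R)
    (p : R -> nonslack N -> R) : Prop :=
  forall t v, 0 <= t <= T -> 0 < node_pressure (ps t) (p t) v.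

Definition total_density (p : nonslack N -> R) (j : nonslack N) : R :=
  p j / c2 j.

Definition partial_density (p : nonslack N -> R) (m : 'I_2)
    (j : nonslack N) : R :=
  eta M j m * total_density p j.

Definition slack_density (t : R) (ps : slack N -> R) (m : 'I_2)
    (i : slack N) : R :=
  alpha M t i m * ps i / a2 t i.

Definition inlet_density (t : R) (ps : slack N -> R) (p : nonslack N -> R)
    (m : 'I_2) (k : edge N) : R :=
  mu_in C t k * match tail k with
                | inl i => slack_density t ps m i
                | inr i => partial_density p m i
                end.

Definition outlet_density (t : R) (p : nonslack N -> R) (m : 'I_2)
    (k : edge N) : R :=
  mu_out C t k * partial_density p m (head k).

(* Since [x / 0 = 0], the bounds are vacuous for a gas that is absent from both
   ends of an edge.  If it is absent from exactly one end, one of the two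
   quotients equals 1 and the condition fails. *)
Definition density_ratio (T : R) (ps : R -> slack N -> R)
    (p : R -> nonslack N -> R) : Prop :=
  exists2 eps : R, eps <= 1 &
    forall t k m, 0 <= t <= T ->
      let rin := inlet_density t (ps t) (p t) m k in
      let rout := outlet_density t (p t) m k in
      `|rout - rin| / rin < eps /\ `|rout - rin| / rout < eps.

End System.

(* Main.v *)
(* On an edge with inlet pressure [y] and outlet pressure [x] the flux is a
   constant times [sqrt (x * (y - x))].  It is increasing in [y], and decreasing
   in [x] when [y <= 2 * x], which is what the density-ratio condition gives; the
   system is then cooperative.  The flux need not be Lipschitz, since [y - x] has
   no positive lower bound, but it is homogeneous of degree 1.  So the ratios
   [u_j = p1_j / p2_j] are compared instead of the differences: if [u_j = s > 1]
   is the largest ratio, then [p1 <= s * p2] with equality at [j], hence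
   [p1_j' <= s * p2_j'], that is, [u_j' <= 0].  By a maximum principle the ratios
   never exceed 1. *)

Require Import Defs.
From mathcomp Require Import all_boot all_order all_algebra.
From mathcomp Require Import all_classical all_reals all_analysis.
From mathcomp Require Import ring lra.
Import Order.TTheory GRing.Theory Num.Theory.
Import numFieldNormedType.Exports.

Set Implicit Arguments.
Unset Strict Implicit.
Unset Printing Implicit Defensive.

Local Open Scope classical_set_scope.
Local Open Scope ring_scope.

(** * Maximum principle for finitely many functions of time *)

(** If the bound fails at [b], the functions [(u i t - K) * (b - t)] have a positive joint maximum,
    at an interior time [c] and an index [j]. There the derivative vanishes, so
    [(b - c) * u_j'(c) = u_j(c) - K > 0], against [u_j'(c) <= 0]. *)
Lemma max_principle_itv (R : realType) (I : finType) (u : I -> R -> R)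
    (K a b : R) :
  (forall i, {within `[a, b], continuous (u i)}) ->
  (forall t i, a < t < b -> derivable (u i) t 1) ->
  (forall t j, a < t < b -> K < u j t -> (forall i, u i t <= u j t) ->
     derive1 (u j) t <= 0) ->
  a < b -> (forall i, u i a <= K) -> forall i, u i b <= K.
Proof.
move=> cu du hu ab ua i0; rewrite leNgt; apply/negP => Ki0.
(* The factor [b - t] moves the maximum off the endpoint [b], where nothing is
   known about the derivative. *)
pose g i t := (u i t - K) * (b - t).
have cg i : {within `[a, b], continuous (g i)}.
  apply/subspace_continuousP => x xab; apply: cvgM.
    have /subspace_continuousP/(_ x xab) cux := cu i.
    by apply: cvgB cux _; exact: cvg_cst.
  by apply: cvgB; [exact: cvg_cst | apply: cvg_within].
have /fin_all_exists2[c cab cmax] : forall i, exists2 c, c \in `[a, b] &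
    forall t, t \in `[a, b] -> g i t <= g i c.
  by move=> i; exact: EVT_max (ltW ab) (cg i).
(* All [g i] vanish at [b]; left continuity of [u i0] moves the excess over [K] to an interior time,
   where [g i0] is positive. *)
have [x axb ux] : exists2 x, a < x < b & K < u i0 x.
  have [_ _ /cvgr_gt/(_ _ Ki0) near_b] := (continuous_within_itvP _ ab).1 (cu i0).
  have near_ab : \forall x \near b^'-, a < x < b.
    by near=> x; apply/andP; split; near: x;
      [exact: nbhs_left_gt | exact: nbhs_left_lt].
  have [x [? ?]] := filter_ex (filterI near_ab near_b).
  by exists x.
have [j _ jmax] := @arg_maxP _ _ _ i0 xpredT (fun i => g i (c i)) isT.
have gle i t : a <= t <= b -> g i t <= g j (c j).
  by move=> tab; apply: le_trans (jmax i isT); apply: cmax; rewrite in_itv.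
have gpos : 0 < g j (c j).
  case/andP: axb => ax xb; apply: (lt_le_trans _ (gle i0 x _)).
    by apply: mulr_gt0; lra.
  by lra.
have cjab : a < c j < b.
  have := cab j; rewrite in_itv /= => /andP[ac cb]; apply/andP; split.
    rewrite lt_neqAle ac andbT; apply/eqP => ac'; move: gpos.
    rewrite /g -ac' ltNge => /negP; apply; have := ua j; nra.
  by rewrite lt_neqAle cb andbT; apply/eqP => cb'; move: gpos;
    rewrite /g cb' subrr mulr0 ltxx.
have [acj cjb] := andP cjab.
have bc : 0 < b - c j by rewrite subr_gt0.
have Kuj : K < u j (c j) by move: gpos; rewrite /g pmulr_lgt0 // subr_gt0.
have ujmax i : u i (c j) <= u j (c j).
  by have := gle i (c j); rewrite (ltW acj) (ltW cjb) => /(_ isT);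
    rewrite /g ler_pM2r // lerD2r.
have uj' := hu (c j) j cjab Kuj ujmax.
have dg t : a < t < b ->
    is_derive t 1 (g j) ((u j t - K) * - 1 + (b - t) * derive1 (u j) t).
  move=> tab; have := du t j tab => /derivableP duj.
  rewrite derive1E.
  have -> : g j = (u j - cst K) * (cst b - id) by [].
  by apply: is_deriveM; [rewrite -[X in is_derive _ _ _ X]subr0 |
    rewrite -[X in is_derive _ _ _ X]sub0r]; apply: is_deriveB.
have g0 : is_derive (c j) 1 (g j) 0.
  apply: (@derive1_at_max _ _ a b); rewrite ?in_itv ?ltW //.
  - by move=> t; rewrite in_itv /= => /dg[].
  - by move=> t; rewrite in_itv /= => /andP[? ?]; apply: gle; lra.
have := @derive_val _ _ _ _ _ _ _ (dg _ cjab).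
rewrite (@derive_val _ _ _ _ _ _ _ g0); nra.
Unshelve. all: by end_near. Qed.

(* The finitely many times in [s] are removed one by one by cutting [a, b]. *)
Lemma max_principle (R : realType) (I : finType) (u : I -> R -> R)
    (K : R) (s : seq R) (a b : R) :
  (forall i, {within `[a, b], continuous (u i)}) ->
  (forall t i, a < t < b -> t \notin s -> derivable (u i) t 1) ->
  (forall t j, a < t < b -> t \notin s ->
     K < u j t -> (forall i, u i t <= u j t) -> derive1 (u j) t <= 0) ->
  a <= b -> (forall i, u i a <= K) -> forall i, u i b <= K.
Proof.
elim: s a b => [|x s IHs] a b cu du hu.
  rewrite le_eqVlt => /predU1P[->//|ab].
  by apply: max_principle_itv => // [t i ?|t i ?]; [exact: du | exact: hu].
have sub c d : a <= c -> d <= b -> ~~ (c < x < d) ->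
    c <= d -> (forall i, u i c <= K) -> forall i, u i d <= K.
  move=> ac db xcd; have notin t : c < t < d -> t \notin s -> t \notin x :: s.
    by move=> tcd ts; rewrite inE negb_or ts andbT;
      apply: contraNneq xcd => <-.
  have lift t : c < t < d -> a < t < b by move=> /andP[? ?]; apply/andP; split; lra.
  apply: IHs => [i|t i tcd ts|t j tcd ts].
  - by apply: continuous_subspaceW (cu i); apply: subset_itv; rewrite ?bnd_simp.
  - by apply: du; [exact: lift | exact: notin].
  - by apply: hu; [exact: lift | exact: notin].
move=> ab ua.
have [/andP[ax xb]|xab] := boolP (a < x < b); last exact: sub.
apply: (sub x b) => //; rewrite ?ltxx ?(ltW ax) ?(ltW xb) //.
by apply: (sub a x) => //; rewrite ?ltxx ?andbF ?(ltW ax) ?(ltW xb).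
Qed.

(** * Pressures and densities at the ends of an edge *)

Section Network.
Variables (R : realType) (N : network R) (C : controls N) (M : mixture N).
Implicit Type k : edge N.

Definition inlet_pressure (t : R) (ps : slack N -> R) (p : nonslack N -> R)
    (k : edge N) : R :=
  mu_in C t k * node_pressure ps p (tail k).

Definition outlet_pressure (t : R) (p : nonslack N -> R) (k : edge N) : R :=
  mu_out C t k * p (Defs.head k).

(** This collects, at one instant, what the flux comparison uses of positive pressure, positive flow
    and the density-ratio condition. *)
Definition monotone_regime (t : R) (ps : slack N -> R) (p : nonslack N -> R) : Prop :=
  forall k, [/\ 0 < outlet_pressure t p k,
                outlet_pressure t p k < inlet_pressure t ps p k
              & inlet_pressure t ps p k <= 2 * outlet_pressure t p k].

(** A zero sum of nonnegative terms would force every concentration to vanish, but they add up to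
    1. *)
Lemma mix_speed2_gt0 (x : 'I_2 -> R) :
  (forall m, 0 < sigma M m) -> concentration x -> 0 < mix_speed2 M x.
Proof.
move=> sigma_gt0 [x01 sumx].
have x_ge0 m : 0 <= x m by have /andP[] := x01 m.
have ge0 m : 0 <= sigma M m ^+ 2 * x m by rewrite mulr_ge0 ?sqr_ge0.
rewrite lt_neqAle sumr_ge0 // andbT eq_sym; apply/eqP => /psumr_eq0P eq0.
have /eqP := sumx; rewrite big1 ?(eq_sym 0) ?oner_eq0 // => m _.
have /eqP := eq0 (fun m _ => ge0 m) m isT.
by rewrite mulf_eq0 gt_eqF ?exprn_gt0 //= => /eqP.
Qed.

Lemma c2_gt0 (T : R) (j : nonslack N) : admissible_mixture M T -> 0 < c2 M j.
Proof. by case=> sigma_gt0 _ _ heta; exact: mix_speed2_gt0. Qed.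

Lemma a2_gt0 (T t : R) (i : slack N) :
  admissible_mixture M T -> 0 <= t <= T -> 0 < a2 M t i.
Proof. by case=> sigma_gt0 halpha _ _ tT; apply: mix_speed2_gt0 => //; exact: halpha. Qed.

(** Dalton's law: gas [m] contributes the partial pressure [sigma_m ^ 2] times its density, and the
    weighted concentrations sum to the squared wave speed in the denominator. *)
Lemma inlet_pressure_density (T t : R) ps p k :
  admissible_mixture M T -> 0 <= t <= T ->
  inlet_pressure t ps p k = \sum_m sigma M m ^+ 2 * inlet_density C M t ps p m k.
Proof.
move=> hM tT; rewrite /inlet_pressure /inlet_density.
have mixE (x : 'I_2 -> R) (P : R) : mix_speed2 M x != 0 ->
    mu_in C t k * P =
    \sum_m sigma M m ^+ 2 * (mu_in C t k * (x m * (P / mix_speed2 M x))).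
  move=> x0; under eq_bigr do rewrite mulrCA.
  rewrite -mulr_sumr; under eq_bigr do rewrite (mulrA (_ ^+ 2)).
  by rewrite -mulr_suml -/(mix_speed2 M x) (mulrC (mix_speed2 M x)) divfK.
case: (tail k) => i /=; rewrite /slack_density /partial_density /total_density.
  rewrite (mixE _ _ (lt0r_neq0 (a2_gt0 i hM tT))).
  by under [RHS]eq_bigr do rewrite -(mulrA (alpha _ _ _ _)).
by rewrite (mixE _ _ (lt0r_neq0 (c2_gt0 i hM))).
Qed.

Lemma outlet_pressure_density (T t : R) p k :
  admissible_mixture M T ->
  outlet_pressure t p k = \sum_m sigma M m ^+ 2 * outlet_density C M t p m k.
Proof.
move=> hM; rewrite /outlet_pressure /outlet_density /partial_density /total_density.
under eq_bigr do rewrite mulrCA.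
rewrite -mulr_sumr; under eq_bigr do rewrite (mulrA (_ ^+ 2)).
rewrite -mulr_suml -/(mix_speed2 M (eta M (Defs.head k))) -/(c2 M (Defs.head k)).
by rewrite (mulrC (c2 M _)) divfK // gt_eqF ?(c2_gt0 _ hM).
Qed.

(** For [y > 0] the second quotient gives [x - y < y]. For [y = 0] that quotient is 0 by convention,
    and the first one, equal to 1 when [x > 0], excludes the case. *)
Lemma density_ratio_le2 (x y eps : R) : 0 <= x -> 0 <= y -> eps <= 1 ->
  `|y - x| / x < eps -> `|y - x| / y < eps -> x <= 2 * y.
Proof.
move=> x0 y0 eps1 hx hy.
have [->|xn0] := eqVneq x 0; first by rewrite mulr_ge0.
have xgt0 : 0 < x by rewrite lt_neqAle eq_sym xn0.
move: y0; rewrite le_eqVlt => /predU1P[y0|ygt0].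
  by move: hx; rewrite -y0 sub0r normrN gtr0_norm // divff // ltNge eps1.
have : `|y - x| < y by rewrite -[X in _ < X]mul1r -ltr_pdivrMr // (lt_le_trans hy).
rewrite ltr_norml; lra.
Qed.

Lemma outlet_pressure_gt0 (T t : R) ps p k :
  admissible_controls C T -> positive_pressure T ps p -> 0 <= t <= T ->
  0 < outlet_pressure t (p t) k.
Proof.
move=> hC hpos tT; have [_ /(_ t tT) mu1 _ _] := hC k.
apply: mulr_gt0; first exact: lt_le_trans mu1.
exact: (hpos t (inr (Defs.head k))).
Qed.

(** The factor multiplying the sign is nonnegative, and nonzero because the flux is; hence the sign
    itself is positive. *)
Lemma flux_gt0_lt (t : R) ps p k :
  0 < flux C M t ps p k -> outlet_pressure t p k < inlet_pressure t ps p k.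
Proof.
rewrite /flux -/(inlet_pressure t ps p k) -/(outlet_pressure t p k) -mulrA.
move=> h; rewrite -subr_gt0 -sgr_gt0.
by rewrite -(@pmulr_lgt0 _ (Lam k *
  Num.sqrt `|outlet_pressure t p k / c2 M (Defs.head k) *
             (inlet_pressure t ps p k - outlet_pressure t p k)|)) //
  lt_neqAle mulr_ge0 ?sqrtr_ge0 // andbT eq_sym;
  apply: contraTneq h => ->; rewrite mulr0 ltxx.
Qed.

Lemma mulr_sqrtr (s x : R) : 0 <= s -> s * Num.sqrt x = Num.sqrt (s ^+ 2 * x).
Proof. by move=> s0; rewrite sqrtrM ?sqr_ge0 // sqrtr_sqr ger0_norm. Qed.

Lemma flux_regimeE (t : R) ps p k : 0 < c2 M (Defs.head k) ->
  monotone_regime t ps p ->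
  flux C M t ps p k =
  Lam k * Num.sqrt (outlet_pressure t p k / c2 M (Defs.head k) *
                    (inlet_pressure t ps p k - outlet_pressure t p k)).
Proof.
move=> c0 /(_ k)[x0 xy _]; rewrite /flux -/(inlet_pressure t ps p k).
rewrite -/(outlet_pressure t p k) gtr0_sg ?subr_gt0 // mul1r ger0_norm //.
by rewrite mulr_ge0 ?divr_ge0 ?subr_ge0 ?ltW.
Qed.

Lemma solution_monotone_regime (T t : R) ps p :
  admissible_controls C T -> admissible_mixture M T ->
  positive_flow C M T ps p -> positive_pressure T ps p ->
  density_ratio C M T ps p -> 0 <= t <= T ->
  monotone_regime t (ps t) (p t).
Proof.
move=> hC hM hflow hpos [eps eps1 hdens] tT k; split.
- exact: outlet_pressure_gt0 hC hpos tT.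
- exact: flux_gt0_lt (hflow t k tT).
(* Weighting the partial densities by [sigma_m ^ 2] recovers pressures, so the
   density ratios bound the pressure ratio even if the mixture changes along
   the edge. *)
rewrite (inlet_pressure_density _ _ _ hM tT) (outlet_pressure_density _ _ _ hM).
rewrite mulr_sumr; apply: ler_sum => m _; rewrite [leRHS]mulrCA ler_wpM2l ?sqr_ge0 //.
have [hin hout] := hdens t k m tT.
have [/(_ t tT)/(le_trans ler01) mi0 /(_ t tT)/(le_trans ler01) mo0 _ _] := hC k.
have [_ halpha _ heta] := hM.
have part_ge0 i : 0 <= partial_density M (p t) m i.
  have [/(_ m)/andP[e0 _] _] := heta i.
  have p0 := hpos t (inr i) tT.
  by rewrite mulr_ge0 // divr_ge0 // ?(ltW (c2_gt0 _ hM)) // ltW.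
apply: density_ratio_le2 eps1 hin hout.
  apply: mulr_ge0 => //; case: (tail k) => i //.
  have [/(_ m)/andP[a0 _] _] := halpha t i tT.
  have p0 := hpos t (inl i) tT.
  by rewrite /slack_density divr_ge0 ?(ltW (a2_gt0 _ hM tT)) // mulr_ge0 // ltW.
exact: mulr_ge0.
Qed.

(** * Comparison of fluxes and net inflows with a scaled solution *)

(** For edges entering the node of largest ratio. By homogeneity the right side is the flux at the
    scaled pressures, which share the outlet pressure, so only the monotonicity in the inlet
    pressure matters. *)
Lemma flux_le_scale_head (t s : R) ps1 ps2 p1 p2 k : 0 < c2 M (Defs.head k) ->
  monotone_regime t ps1 p1 -> monotone_regime t ps2 p2 -> 0 <= s ->
  outlet_pressure t p1 k = s * outlet_pressure t p2 k ->
  inlet_pressure t ps1 p1 k <= s * inlet_pressure t ps2 p2 k ->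
  flux C M t ps1 p1 k <= s * flux C M t ps2 p2 k.
Proof.
move=> c0 h1 h2 s0 xE yle; rewrite !flux_regimeE //.
rewrite [leRHS]mulrCA ler_wpM2l ?sqrtr_ge0 // mulr_sqrtr //; apply: ler_wsqrtr.
have [x1 _ _] := h1 k; rewrite !(mulrAC _ (_^-1)) mulrA ler_wpM2r ?invr_ge0 ?(ltW c0) //.
rewrite -subr_ge0 xE; move: x1 yle; rewrite xE.
set x := outlet_pressure t p2 k; set y := inlet_pressure t ps1 p1 k.
set Y := inlet_pressure t ps2 p2 k => x1 yle.
have -> : s ^+ 2 * (x * (Y - x)) - s * x * (y - s * x) =
  s * x * (s * Y - y) by ring.
by rewrite mulr_ge0 ?subr_ge0 // ltW.
Qed.

(** For edges leaving that node: now the inlet pressures agree after scaling, and the flux decreases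
    in the outlet pressure. *)
Lemma flux_ge_scale_tail (t s : R) ps1 ps2 p1 p2 k : 0 < c2 M (Defs.head k) ->
  monotone_regime t ps1 p1 -> monotone_regime t ps2 p2 -> 0 <= s ->
  inlet_pressure t ps1 p1 k = s * inlet_pressure t ps2 p2 k ->
  outlet_pressure t p1 k <= s * outlet_pressure t p2 k ->
  s * flux C M t ps2 p2 k <= flux C M t ps1 p1 k.
Proof.
move=> c0 h1 h2 s0 yE xle; rewrite !flux_regimeE //.
rewrite mulrCA ler_wpM2l ?sqrtr_ge0 // mulr_sqrtr //; apply: ler_wsqrtr.
have [_ _ yx] := h1 k; rewrite !(mulrAC _ (_^-1)) mulrA ler_wpM2r ?invr_ge0 ?(ltW c0) //.
rewrite -subr_ge0; move: yx xle; rewrite yE.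
set x := outlet_pressure t p1 k; set X := outlet_pressure t p2 k.
set Y := inlet_pressure t ps2 p2 k => yx xle.
(* The second factor is nonnegative because [s * Y <= 2 * x <= x + s * X]; this is where the factor
   2 of the regime enters. *)
have -> : x * (s * Y - x) - s ^+ 2 * (X * (Y - X)) =
  (s * X - x) * (x + s * X - s * Y) by ring.
by apply: mulr_ge0; lra.
Qed.

(** Outgoing fluxes carry a minus sign, hence the reversed inequality for them. Slack pressures and
    injections are not rescaled: [1 <= s] and their signs give [ps1 <= ps2 <= s * ps2] and
    [q1 <= q2 <= s * q2]. *)
Lemma net_inflow_le_scale (T t s : R) ps1 ps2 p1 p2 q1 q2 j :
  admissible_controls C T -> admissible_mixture M T -> 0 <= t <= T ->
  monotone_regime t ps1 p1 -> monotone_regime t ps2 p2 ->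
  (forall v, 0 < node_pressure ps2 p2 v) ->
  1 <= s -> (forall i, ps1 i <= ps2 i) -> 0 <= q2 j -> q1 j <= q2 j ->
  p1 j = s * p2 j -> (forall i, p1 i <= s * p2 i) ->
  net_inflow C M t ps1 p1 q1 j <= s * net_inflow C M t ps2 p2 q2 j.
Proof.
move=> hC hM tT h1 h2 pos2 s1 hps q20 hq pj ple.
have s0 : 0 <= s by exact: le_trans ler01 s1.
have chi_ge0 k : 0 <= chi k.
  by rewrite divr_ge0 // mulr_ge0 ?pi_ge0 // sqr_ge0.
have theta_ge0 v : 0 <= theta2 M t v.
  by case: v => i /=; rewrite ltW // ?(a2_gt0 _ hM) ?(c2_gt0 _ hM).
have node_le v : node_pressure ps1 p1 v <= s * node_pressure ps2 p2 v.
  case: v => i //=; apply: le_trans (hps i) _.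
  by rewrite ler_peMl // ltW // (pos2 (inl i)).
have mu_ge0 k : 0 <= mu_in C t k /\ 0 <= mu_out C t k.
  by have [/(_ t tT) ? /(_ t tT) ? _ _] := hC k; split; apply: le_trans ler01 _.
have b2_ge0 : 0 <= b2 M t j.
  have [sigma_gt0 _ hbeta _] := hM.
  by apply/ltW/mix_speed2_gt0 => //; exact: hbeta.
rewrite /net_inflow mulrDr mulrBr; apply: lerD.
  apply: lerB; rewrite mulr_sumr; apply: ler_sum => k.
    move=> /eqP kj; rewrite [leRHS]mulrCA ler_wpM2l ?(mulr_ge0 (theta_ge0 _) (chi_ge0 k)) //.
    have [mi mo] := mu_ge0 k.
    apply: flux_le_scale_head; rewrite ?(c2_gt0 _ hM) //.
      by rewrite /outlet_pressure kj pj mulrCA.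
    by rewrite /inlet_pressure [leRHS]mulrCA ler_wpM2l.
  move=> /eqP kj; rewrite mulrCA ler_wpM2l ?(mulr_ge0 (theta_ge0 (inr j)) (chi_ge0 k)) //.
  have [mi mo] := mu_ge0 k.
  apply: flux_ge_scale_tail; rewrite ?(c2_gt0 _ hM) //.
    by rewrite /inlet_pressure kj /= pj mulrCA.
  by rewrite /outlet_pressure [leRHS]mulrCA ler_wpM2l.
rewrite [leRHS]mulrCA ler_wpM2l // (le_trans hq) // ler_peMl //.
Qed.

Lemma capacity_gt0 (T t : R) (j : nonslack N) :
  admissible_controls C T -> 0 <= t <= T -> 0 < capacity C t j.
Proof.
move=> hC tT; have [k0 /eqP k0j] := network_incoming j.
have term_gt0 k : 0 < chi k * len k * mu_out C t k.
  have [_ /(_ t tT) mo _ _] := hC k.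
  apply: mulr_gt0 (lt_le_trans ltr01 mo); apply: mulr_gt0 (len_gt0 k).
  by rewrite divr_gt0 // mulr_gt0 ?pi_gt0 // exprn_gt0 // diam_gt0.
rewrite /capacity (bigD1 k0) //= ltr_wpDr //.
by rewrite sumr_ge0 // => k _; exact: ltW.
Qed.

End Network.

(** * Comparison of the two solutions *)

Theorem corollary1 (R : realType) (N : network R) (C : controls N) (M : mixture N)
  (T : R) (pi1 pi2 : nonslack N -> R) (ps1 ps2 : R -> slack N -> R)
  (q1 q2 p1 p2 : R -> nonslack N -> R)
  (hT : 0 <= T)
  (hC : admissible_controls C T) (hM : admissible_mixture M T)
  (hq1 : injection_flow T q1) (hq2 : injection_flow T q2)
  (hp1 : solution C M T pi1 ps1 q1 p1) (hp2 : solution C M T pi2 ps2 q2 p2)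
  (hflow1 : positive_flow C M T ps1 p1) (hflow2 : positive_flow C M T ps2 p2)
  (hpos1 : positive_pressure T ps1 p1) (hpos2 : positive_pressure T ps2 p2)
  (hdens1 : density_ratio C M T ps1 p1) (hdens2 : density_ratio C M T ps2 p2)
  (hpi : forall j, pi1 j <= pi2 j)
  (hps : forall (t : R) i, 0 <= t <= T -> ps1 t i <= ps2 t i)
  (hd : forall (t : R) j, 0 <= t <= T -> flow_input q1 t j >= flow_input q2 t j) :
  forall (m : 'I_2) (t : R) (j : nonslack N), 0 <= t <= T ->
    partial_density M (p1 t) m j <= partial_density M (p2 t) m j.
Proof.
have p2_gt0 t i : 0 <= t <= T -> 0 < p2 t i by move=> /(hpos2 t (inr i)).
(* Each partial density is the pressure times [eta / c2], a nonnegative constant common to both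
   solutions. *)
suff ple t j : 0 <= t <= T -> p1 t j <= p2 t j.
  move=> m t j tT; have [_ _ _ heta] := hM.
  have [/(_ m)/andP[eta0 _] _] := heta j.
  by rewrite ler_wpM2l // ler_wpM2r ?ple // invr_ge0 (ltW (c2_gt0 _ hM)).
move=> /andP[t0 tT].
have [init1 cont1 [s1 ode1]] := hp1; have [init2 cont2 [s2 ode2]] := hp2.
have inT x : 0 < x < t -> 0 < x < T.
  by move=> /andP[x0 xt]; rewrite x0 (lt_le_trans xt tT).
have inT' x : 0 < x < t -> 0 <= x <= T.
  by move=> /inT/andP[? ?]; apply/andP; split; exact: ltW.
pose u i x := p1 x i / p2 x i.
(* The quotient rule in this form shows that [u i] has a nonpositive derivative exactly when
   [p1' <= u * p2']. *)
have du x i : 0 < x < t -> x \notin s1 ++ s2 ->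
    is_derive x 1 (u i) ((derive1 (p1^~ i) x - u i x * derive1 (p2^~ i) x) / p2 x i).
  move=> xt; rewrite mem_cat negb_or => /andP[xs1 xs2].
  have p2x := p2_gt0 x i (inT' _ xt); have p2n0 := lt0r_neq0 p2x.
  have [/derivableP d1 _] := ode1 x i (inT _ xt) xs1.
  have [/derivableP d2 _] := ode2 x i (inT _ xt) xs2.
  rewrite !derive1E; apply: is_derive_eq (is_deriveM d1 (is_deriveV p2n0 d2)) _.
  by rewrite /u /GRing.scale /=; field.
suff : u j t <= 1 by rewrite ler_pdivrMr ?mul1r // p2_gt0 // t0.
apply: (@max_principle _ _ u 1 (s1 ++ s2) 0 t) => //.
- move=> i; apply/subspace_continuousP => x /=; rewrite in_itv /= => /andP[x0 xt].
  have xT : 0 <= x <= T by rewrite x0 (le_trans xt tT).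
  have sub : `[0, t] `<=` `[0, T] by apply: subset_itv; rewrite ?bnd_simp.
  have xin : [set` `[0, t]] x by rewrite /= in_itv /= x0.
  have /subspace_continuousP/(_ x xin) c1 := continuous_subspaceW sub (cont1 i).
  have /subspace_continuousP/(_ x xin) c2 := continuous_subspaceW sub (cont2 i).
  by apply: cvgM c1 _; apply: cvgV c2; rewrite gt_eqF ?p2_gt0.
- by move=> x i xt xs; have [] := du x i xt xs.
- move=> x i xt xs uge1 umax.
  have xT := inT' _ xt; have p2x := p2_gt0 x i xT.
  rewrite derive1E (@derive_val _ _ _ _ _ _ _ (du x i xt xs)).
  rewrite ler_pdivrMr // mul0r subr_le0.
  move: xs; rewrite mem_cat negb_or => /andP[xs1 xs2].
  have [_ e1] := ode1 x i (inT _ xt) xs1; have [_ e2] := ode2 x i (inT _ xt) xs2.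
  (* The capacity depends only on the network and the controls, so the same factor turns both
     derivatives into net inflows, compared with [s = u i x]. *)
  rewrite -(ler_pM2l (capacity_gt0 i hC xT)) mulrCA e1 e2.
  apply: (net_inflow_le_scale hC hM xT) => //.
  + exact: solution_monotone_regime hdens1 xT.
  + exact: solution_monotone_regime hdens2 xT.
  + by move=> v; exact: hpos2.
  + exact: ltW.
  + by move=> k; exact: hps.
  + by have [/(_ x xT)] := hq2 i.
  + by have := hd x i xT; rewrite /flow_input lerN2.
  + by rewrite /u divfK ?gt_eqF.
  + by move=> k; rewrite -ler_pdivrMr ?p2_gt0 //; exact: umax.
- move=> i; rewrite /u ler_pdivrMr ?mul1r ?p2_gt0 ?lexx //.
  by rewrite init1 init2.
Qed.
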